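(* Let $(H,\circ)$ be a hypersemigroup. Then $H$ is simple if and only if every fuzzy interior ideal of $H$ is a constant function.
   Context: A hypergroupoid is a nonempty set $H$ with a map $\circ: H\times H\to \mathcal{P}^*(H)$, where $\mathcal{P}^*(H)$ is the set of nonempty subsets of $H$. For $A,B\in\mathcal{P}^*(H)$ put $A*B=\bigcup_{(a,b)\in A\times B}(a\circ b)$; thus $\{x\}*\{y\}=x\circ y$. A hypersemigroup is a hypergroupoid with $\{x\}*(y\circ z)=(x\circ y)*\{z\}$ for all $x,y,z\in H$; then $*$ is associative on $\mathcal{P}^*(H)$. A nonempty subset $A$ of $H$ is an ideal of $H$ if $H*A\subseteq A$ and $A*H\subseteq A$. $H$ is simple if every ideal $A$ of $H$ satisfies $A=H$. A fuzzy subset of $H$ is a map $f:H\to[0,1]$ (real interval). It is a fuzzy interior ideal if for all $x,a,y\in H$ and all $u\in (x\circ a)*\{y\}$, $f(u)\ge f(a)$. *)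

(* Defs.v *)
From mathcomp Require Import all_boot all_order all_algebra.
From mathcomp Require Import interval_inference classical_sets reals.

Set Implicit Arguments.
Unset Strict Implicit.
Unset Printing Implicit Defensive.

Import Order.TTheory GRing.Theory Num.Theory.
Local Open Scope classical_set_scope.
Local Open Scope ring_scope.

Record hypergroupoid := Hypergroupoid {
  hg_sort :> Type;
  hg_inhabited : inhabited hg_sort;
  hop : hg_sort -> hg_sort -> set hg_sort;
  hop_nonempty : forall x y, hop x y !=set0
}.

(* Defined on all subsets rather than only on the nonempty ones: the union is
   again nonempty whenever A and B are. *)
Definition hmul (H : hypergroupoid) (A B : set H) : set H :=
  \bigcup_(p in A `*` B) hop p.1 p.2.

Definition hypersemigroup (H : hypergroupoid) : Prop :=
  forall x y z : H, hmul [set x] (hop y z) = hmul (hop x y) [set z].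

Definition hideal (H : hypergroupoid) (A : set H) : Prop :=
  [/\ A !=set0, hmul setT A `<=` A & hmul A setT `<=` A].

Definition hsimple (H : hypergroupoid) : Prop :=
  forall A : set H, hideal A -> A = setT.

Definition fuzzy_subset (R : realType) (H : hypergroupoid) : Type :=
  H -> {i01 R}.

Definition fuzzy_interior_ideal (R : realType) (H : hypergroupoid)
    (f : fuzzy_subset R H) : Prop :=
  forall x a y u : H, hmul (hop x a) [set y] u -> (f a)%:num <= (f u)%:num.

(* Main.v *)
Require Import Defs.
From mathcomp Require Import all_boot all_order all_algebra.
From mathcomp Require Import interval_inference classical_sets reals.
From mathcomp Require Import boolp.

(** The sets [H * {a} * H] and the characteristic functions of ideals carry the
    proof.

    A fuzzy interior ideal [f] takes values at least [f a] on [H * {a} * H]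
    ([sandwich] below), which is an ideal by associativity.  When [H] is simple
    this ideal is all of [H], so [f a] is the minimum of [f]; as [a] is
    arbitrary, [f] is constant.

    Conversely, the characteristic function of an ideal [A] is a fuzzy interior
    ideal, because a product [x * a * y] with [a] in [A] stays in [A].  If it is
    constant, its value is [1], since [A] is nonempty, and hence [A] is [H]. *)

Set Implicit Arguments.
Unset Strict Implicit.
Unset Printing Implicit Defensive.

Import Order.TTheory GRing.Theory Num.Theory.
Local Open Scope classical_set_scope.
Local Open Scope ring_scope.

Lemma hmul1l (H : hypergroupoid) (x : H) (B : set H) (w : H) :
  hmul [set x] B w <-> exists2 u, B u & hop x u w.
Proof.
split=> [[[p q] [/= -> Bq] pqw]|[u Bu xuw]]; first by exists q.
by exists (x, u).
Qed.

Lemma hmul1r (H : hypergroupoid) (A : set H) (y w : H) :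
  hmul A [set y] w <-> exists2 u, A u & hop u y w.
Proof.
split=> [[[p q] [/= Ap ->] pqw]|[u Au uyw]]; first by exists p.
by exists (u, y).
Qed.

Lemma hop_assoc (H : hypergroupoid) (hH : hypersemigroup H) (x y z w : H) :
  (exists2 u, hop y z u & hop x u w) <-> (exists2 t, hop x y t & hop t z w).
Proof. by rewrite -hmul1l -hmul1r hH. Qed.

Definition sandwich (H : hypergroupoid) (a : H) : set H :=
  [set u | exists x y, hmul (hop x a) [set y] u].

(** Multiplying [x * a * y] by [z] on the left or on the right and
    reassociating replaces [x] by an element of [z * x], or [y] by one of
    [y * z]. *)
Lemma sandwich_hideal (H : hypergroupoid) (hH : hypersemigroup H) (a : H) :
  hideal (sandwich a).
Proof.
split.
- have [w aaw] := hop_nonempty a a.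
  have [u wau] := hop_nonempty w a.
  by exists u, a, a; apply/hmul1r; exists w.
- move=> v [[z u] [/= _ [x [y /hmul1r[w xaw wyu]]]] zuv].
  have [t zwt tyv] : exists2 t, hop z w t & hop t y v.
    by apply/(hop_assoc hH); exists u.
  have [s _ sat] : exists2 s, hop z x s & hop s a t.
    by apply/(hop_assoc hH); exists w.
  by exists s, y; apply/hmul1r; exists t.
- move=> v [[u z] [/= [x [y /hmul1r[w xaw wyu]]] _] uzv].
  have [t _ wtv] : exists2 t, hop y z t & hop w t v.
    by apply/(hop_assoc hH); exists u.
  by exists x, t; apply/hmul1r; exists w.
Qed.

Definition fuzzy_char (R : realType) (H : hypergroupoid) (A : set H) :
    fuzzy_subset R H :=
  fun x => if `[< A x >] then 1%:i01 else 0%:i01.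

Lemma fuzzy_char_interior_ideal (R : realType) (H : hypergroupoid)
    (A : set H) : hideal A -> fuzzy_interior_ideal (fuzzy_char R A).
Proof.
move=> [_ HA AH] x a y u /hmul1r[w xaw wyu]; rewrite /fuzzy_char.
case: asboolP => [Aa|_]; last by case: ifP => _ /=; rewrite ?ler01.
suff /asboolP -> : A u by [].
by apply: AH; exists (w, y) => //; split=> //=; apply: HA; exists (x, a).
Qed.

Theorem theorem2p24 (R : realType) (H : hypergroupoid)
    (hH : hypersemigroup H) :
  hsimple H <->
  (forall f : fuzzy_subset R H, fuzzy_interior_ideal f ->
     exists c : {i01 R}, forall x : H, f x = c).
Proof.
split=> [simpleH f fI|constH A idA].
- have le_f a b : (f a)%:num <= (f b)%:num.
    have : sandwich a b by rewrite (simpleH _ (sandwich_hideal hH a)).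
    by move=> [x [y]]; apply: fI.
  have [a] := hg_inhabited H.
  exists (f a) => x; apply/val_inj/le_anti.
  by apply/andP; split; apply: le_f.
- have [c cE] := constH _ (fuzzy_char_interior_ideal R idA).
  have [[a Aa] _ _] := idA.
  apply/seteqP; split=> // x _; apply: contrapT => nAx.
  have := etrans (cE a) (esym (cE x)); rewrite /fuzzy_char asboolT// asboolF//.
  by move=> /(congr1 (fun r : {i01 R} => r%:num))/= /eqP; rewrite oner_eq0.
Qed.
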